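(* Let $k$ be an algebraically closed field of characteristic $p>0$, let $V$ be an irreducible quasi-projective variety over $k$, let $g(z)\in k(V)[z]$ be a monic polynomial with $1\leq \deg(g)<p$, and let $d\geq 2$ be an integer. If $g(z^d)$, viewed as a polynomial over an algebraic closure of the function field $k(V)$, is post-critically finite, then all coefficients of $g$ lie in $k$ (i.e., the family $g(z^d)$ is constant).
   Context: A polynomial is post-critically finite (PCF) if the forward orbit of each of its critical points is finite. A PCF algebraic family means a family parametrized by an irreducible quasi-projective variety whose generic fibre is PCF. *)

(* Defs.v *)
From HB Require Import structures.
From mathcomp Require Import all_boot all_algebra generic_quotient ring.
From mathcomp Require Import mpoly boolp.

Set Implicit Arguments.
Unset Strict Implicit.
Unset Printing Implicit Defensive.

Import GRing.Theory.
Local Open Scope ring_scope.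
Local Open Scope quotient_scope.

Section QuasiProjective.
Variable k : closedFieldType.

(* A point of P^n is given by any of its vectors of homogeneous coordinates.
   All the sets below are cut out by forms, so they are invariant under
   nonzero scaling and never depend on the chosen coordinates. *)
Definition nonzero_coords (n : nat) (v : 'I_n.+1 -> k) : Prop :=
  exists i, v i != 0.

Definition zariski_closed (n : nat) (C : ('I_n.+1 -> k) -> Prop) : Prop :=
  exists S : {mpoly k[n.+1]} -> Prop,
    (forall f, S f -> exists d : nat, f \is d.-homog) /\
    (forall v, C v <-> nonzero_coords v /\ forall f, S f -> f.@[v] = 0).

Definition quasi_projective (n : nat) (X : ('I_n.+1 -> k) -> Prop) : Prop :=
  exists C D : ('I_n.+1 -> k) -> Prop,
    [/\ zariski_closed C, zariski_closed D & forall v, X v <-> C v /\ ~ D v].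

Definition zariski_irreducible (n : nat) (X : ('I_n.+1 -> k) -> Prop) : Prop :=
  (exists v, X v) /\
  forall C D : ('I_n.+1 -> k) -> Prop,
    zariski_closed C -> zariski_closed D ->
    (forall v, X v -> C v \/ D v) ->
    (forall v, X v -> C v) \/ (forall v, X v -> D v).

Record irrQPVariety := IrrQPVariety {
  ambient_dim : nat;
  points :> ('I_ambient_dim.+1 -> k) -> Prop;
  points_quasi_projective : quasi_projective points;
  points_irreducible : zariski_irreducible points
}.

End QuasiProjective.

(* The function field k(V): quotients f / h of forms of the same degree with h
   not vanishing identically on V, where f / h and f' / h' are identified when
   f h' = f' h on V. *)
Module FunctionField.
Section FunctionField.
Variables (k : closedFieldType) (V : irrQPVariety k).

Local Notation A := {mpoly k[(ambient_dim V).+1]}.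

Definition is_ratio (x : A * A) : Prop :=
  (exists d : nat, x.1 \is d.-homog /\ x.2 \is d.-homog) /\
  (exists2 v, V v & x.2.@[v] != 0).

Definition ratio := {x : A * A | `[< is_ratio x >]}.

Local Notation num x := (val (x : ratio)).1.
Local Notation den x := (val (x : ratio)).2.

Definition equiv (x y : ratio) : bool :=
  `[< forall v, V v -> (num x * den y).@[v] = (num y * den x).@[v] >].

Definition mk_ratio (x : A * A) (h : is_ratio x) : ratio :=
  exist _ x (asboolT h).

Lemma ratioP (x : ratio) : is_ratio (val x).
Proof. exact/asboolP/(valP x). Qed.

Lemma equivP (x y : ratio) :
  reflect (forall v, V v ->
     (num x).@[v] * (den y).@[v] = (num y).@[v] * (den x).@[v]) (equiv x y).
Proof.
by apply: (iffP (asboolP _)) => h v /h; rewrite !mevalM.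
Qed.

Lemma forms_integral (f h : A) (d e : nat) : f \is d.-homog -> h \is e.-homog ->
  (forall v, V v -> f.@[v] * h.@[v] = 0) ->
  (forall v, V v -> f.@[v] = 0) \/ (forall v, V v -> h.@[v] = 0).
Proof.
move=> hf hh fh0.
pose Z (a : A) v := nonzero_coords v /\ a.@[v] = 0.
have clZ (a : A) (m : nat) : a \is m.-homog -> zariski_closed (Z a).
  move=> ha; exists (fun b => b = a); split; first by move=> _ ->; exists m.
  by move=> v; split=> -[nz h0]; split=> //; [move=> _ -> | apply: h0].
have nzV v : V v -> nonzero_coords v.
  have [C [D [[S [_ hS]] _ hV]]] := points_quasi_projective V.
  by move=> /hV [/hS [] ].
have [_ irr] := points_irreducible V.
case: (irr _ _ (clZ _ _ hf) (clZ _ _ hh)) => [v Vv | h0 | h0].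
- have /eqP := fh0 v Vv; rewrite mulf_eq0.
  by case/orP=> /eqP ?; [left|right]; split=> //; apply: nzV.
- by left=> v /h0 [].
- by right=> v /h0 [].
Qed.

Lemma den_cancel (x : ratio) (f : A) (d : nat) : f \is d.-homog ->
  (forall v, V v -> (den x).@[v] * f.@[v] = 0) -> forall v, V v -> f.@[v] = 0.
Proof.
move=> hf h0; have [[e [_ hx]] [v0 Vv0 nz]] := ratioP x.
have [/(_ v0 Vv0) z | //] := forms_integral hx hf h0.
by rewrite z eqxx in nz.
Qed.

Lemma equiv_refl : reflexive equiv.
Proof. by move=> x; apply/equivP. Qed.

Lemma equiv_sym : ssrbool.symmetric equiv.
Proof. by move=> x y; apply/equivP/equivP=> h v /h ->. Qed.

Lemma equiv_trans : transitive equiv.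
Proof.
move=> y x z /equivP xy /equivP yz; apply/equivP => v Vv.
have [[d [nx dx]] _] := ratioP x; have [[e [nz dz]] _] := ratioP z.
pose f := num x * den z - num z * den x.
have hf : f \is (d + e).-homog.
  by apply: rpredB; [|rewrite addnC]; apply: dhomogM.
apply/eqP; rewrite -subr_eq0 -!mevalM -mevalB; apply/eqP.
apply: (den_cancel (x := y) hf _ Vv) => w Vw.
rewrite /f mevalB !mevalM.
have -> : (den y).@[w] * ((num x).@[w] * (den z).@[w] - (num z).@[w] * (den x).@[w])
  = ((num x).@[w] * (den y).@[w]) * (den z).@[w]
    - ((num z).@[w] * (den y).@[w]) * (den x).@[w] by ring.
by rewrite xy // -yz //; ring.
Qed.

Canonical equiv_equiv := EquivRel equiv equiv_refl equiv_sym equiv_trans.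

Definition type := {eq_quot equiv}.
HB.instance Definition _ : EqQuotient _ equiv type := EqQuotient.on type.
HB.instance Definition _ := Choice.on type.

Lemma repr_equiv (x : ratio) v : V v ->
  (num (repr (\pi_type x))).@[v] * (den x).@[v]
    = (num x).@[v] * (den (repr (\pi_type x))).@[v].
Proof.
move: v; apply/equivP; rewrite -[equiv _ _]/(equiv_equiv _ _).
by apply/eqmodP; rewrite reprK.
Qed.

Lemma mul_den_nz (x y : ratio) : exists2 v, V v & (den x * den y).@[v] != 0.
Proof.
have [[d [_ dx]] _] := ratioP x; have [[e [_ dy]] [v0 Vv0 nz]] := ratioP y.
apply: contrapT => h; move: nz; rewrite (den_cancel (x := x) dy) ?eqxx // => v Vv.
by apply: contrapT => /eqP nz; apply: h; exists v; rewrite ?mevalM.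
Qed.

Lemma add_subproof (x y : ratio) :
  is_ratio (num x * den y + num y * den x, den x * den y).
Proof.
split; last exact: mul_den_nz.
have [[d [nx dx]] _] := ratioP x; have [[e [ny dy]] _] := ratioP y.
exists (d + e)%N; split=> /=; last exact: dhomogM.
by apply: rpredD; [|rewrite addnC]; apply: dhomogM.
Qed.
Definition addr (x y : ratio) : ratio := mk_ratio (add_subproof x y).

Lemma mul_subproof (x y : ratio) :
  is_ratio (num x * num y, den x * den y).
Proof.
split; last exact: mul_den_nz.
have [[d [nx dx]] _] := ratioP x; have [[e [ny dy]] _] := ratioP y.
by exists (d + e)%N; split=> /=; apply: dhomogM.
Qed.
Definition mulr (x y : ratio) : ratio := mk_ratio (mul_subproof x y).

Lemma opp_subproof (x : ratio) : is_ratio (- num x, den x).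
Proof.
have [[d [nx dx]] nz] := ratioP x; split=> //.
by exists d; rewrite /= rpredN.
Qed.
Definition oppr (x : ratio) : ratio := mk_ratio (opp_subproof x).

Lemma const_subproof (c : k) : is_ratio (c%:MP, 1).
Proof.
split; last first.
  by have [[v Vv] _] := points_irreducible V; exists v; rewrite ?meval1 ?oner_eq0.
exists 0%N; split; last exact: dhomog1.
by rewrite /= -[c]mulr1 mpolyCM mpolyC1 mul_mpolyC rpredZ // dhomog1.
Qed.
Definition constr (c : k) : ratio := mk_ratio (const_subproof c).

Definition is_zero (x : ratio) : bool :=
  `[< forall v, V v -> (num x).@[v] = 0 >].

Definition invr (x : ratio) : ratio := insubd (constr 0) (den x, num x).

Lemma val_invr (x : ratio) :
  val (invr x) = if is_zero x then (0%:MP, 1) else (den x, num x).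
Proof.
rewrite val_insubd; case: (boolP (is_zero x)) => [/asboolP z | nz].
  by case: asboolP => // -[_ [v /z /= ->]]; rewrite eqxx.
case: asboolP => // -[]; have [[d [nx dx]] _] := ratioP x.
split; first by exists d.
apply: contrapT => h; move/negP: nz; apply; apply/asboolP => v Vv.
by apply: contrapT => /eqP nz; apply: h; exists v.
Qed.

Lemma is_zero_equiv (x : ratio) : is_zero x = equiv x (constr 0).
Proof.
apply/asboolP/equivP => /= h v /h; rewrite meval1 mevalC mul0r mulr1 //.
Qed.

Definition const := lift_embed type constr.
Canonical const_pi_morph := PiEmbed const.

Definition add := lift_op2 type addr.
Lemma pi_add : {morph \pi : x y / addr x y >-> add x y}.
Proof.
move=> x y; unlock add; apply/eqmodP/equivP => v Vv /=.
have hx := repr_equiv x Vv; have hy := repr_equiv y Vv.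
rewrite !mevalD !mevalM.
set a := (num _).@[v] in hx *; set b := (num _).@[v] in hy *.
move: hx hy.
move: (num x).@[v] (den x).@[v] (num y).@[v] (den y).@[v].
move: a b (den (repr (\pi_type x))).@[v] (den (repr (\pi_type y))).@[v].
move=> a b ad bd n d n' d' hx hy.
have -> : (n * d' + n' * d) * (ad * bd) = (n * ad) * d' * bd + (n' * bd) * d * ad
  by ring.
by rewrite -hx -hy; ring.
Qed.
Canonical pi_add_morph := PiMorph2 pi_add.

Definition mul := lift_op2 type mulr.
Lemma pi_mul : {morph \pi : x y / mulr x y >-> mul x y}.
Proof.
move=> x y; unlock mul; apply/eqmodP/equivP => v Vv /=.
have hx := repr_equiv x Vv; have hy := repr_equiv y Vv.
by rewrite !mevalM mulrACA -hx -hy mulrACA.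
Qed.
Canonical pi_mul_morph := PiMorph2 pi_mul.

Definition opp := lift_op1 type oppr.
Lemma pi_opp : {morph \pi : x / oppr x >-> opp x}.
Proof.
move=> x; unlock opp; apply/eqmodP/equivP => v Vv /=.
by rewrite !mevalN !mulNr repr_equiv.
Qed.
Canonical pi_opp_morph := PiMorph1 pi_opp.

Definition inv := lift_op1 type invr.
Lemma pi_inv : {morph \pi : x / invr x >-> inv x}.
Proof.
move=> x; unlock inv; apply/eqmodP/equivP => v Vv; rewrite !val_invr.
have e : is_zero (repr (\pi_type x)) = is_zero x.
  have exy : equiv (repr (\pi_type x)) x by apply/equivP => w; apply: repr_equiv.
  rewrite !is_zero_equiv; apply/idP/idP; apply: equiv_trans => //.
  by rewrite equiv_sym.
by rewrite e; case: ifP => //= _; rewrite mulrC [RHS]mulrC repr_equiv.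
Qed.
Canonical pi_inv_morph := PiMorph1 pi_inv.

Lemma addA : associative add.
Proof.
elim/quotW=> x; elim/quotW=> y; elim/quotW=> z; rewrite !piE.
by apply/eqmodP/equivP => v Vv /=; rewrite !(mevalM, mevalD); ring.
Qed.

Lemma addC : commutative add.
Proof.
elim/quotW=> x; elim/quotW=> y; rewrite !piE.
by apply/eqmodP/equivP => v Vv /=; rewrite !(mevalM, mevalD); ring.
Qed.

Lemma add0 : left_id (const 0) add.
Proof.
elim/quotW=> x; rewrite !piE.
by apply/eqmodP/equivP => v Vv /=; rewrite !(mevalM, mevalD, mevalC, meval1); ring.
Qed.

Lemma addN : left_inverse (const 0) opp add.
Proof.
elim/quotW=> x; rewrite !piE; apply/eqmodP/equivP => v Vv /=.
by rewrite !(mevalM, mevalD, mevalN, mevalC, meval1); ring.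
Qed.

HB.instance Definition _ := GRing.isZmodule.Build type addA addC add0 addN.

Lemma mulA : associative mul.
Proof.
elim/quotW=> x; elim/quotW=> y; elim/quotW=> z; rewrite !piE.
by apply/eqmodP/equivP => v Vv /=; rewrite !mevalM; ring.
Qed.

Lemma mulC : commutative mul.
Proof.
elim/quotW=> x; elim/quotW=> y; rewrite !piE.
by apply/eqmodP/equivP => v Vv /=; rewrite !mevalM; ring.
Qed.

Lemma mul1 : left_id (const 1) mul.
Proof.
elim/quotW=> x; rewrite !piE.
by apply/eqmodP/equivP => v Vv /=; rewrite !(mevalM, mevalC, meval1); ring.
Qed.

Lemma mulDl : left_distributive mul add.
Proof.
elim/quotW=> x; elim/quotW=> y; elim/quotW=> z; rewrite !piE.
by apply/eqmodP/equivP => v Vv /=; rewrite !(mevalM, mevalD); ring.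
Qed.

Lemma nonzero1 : const 1 != const 0.
Proof.
rewrite piE; apply/negP => /equivP /=.
have [[v Vv] _] := points_irreducible V => /(_ v Vv).
by rewrite !(mevalC, meval1) !mulr1 => /eqP; rewrite oner_eq0.
Qed.

HB.instance Definition _ :=
  GRing.Zmodule_isComNzRing.Build type mulA mulC mul1 mulDl nonzero1.

Lemma mulV (a : type) : a != const 0 -> mul (inv a) a = const 1.
Proof.
elim/quotW: a => x; rewrite !piE /= -is_zero_equiv => nz.
apply/eqmodP/equivP => v Vv; rewrite /= val_invr (negPf nz) /=.
by rewrite !(mevalM, mevalC, meval1); ring.
Qed.

Lemma inv0 : inv (const 0) = const 0.
Proof.
rewrite !piE; apply/eqmodP/equivP => v Vv.
by rewrite val_invr is_zero_equiv equiv_refl.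
Qed.

HB.instance Definition _ := GRing.ComNzRing_isField.Build type mulV inv0.

Lemma const_zmod_morphism : zmod_morphism const.
Proof.
move=> c e; rewrite -[RHS]/(add (const c) (opp (const e))) !piE.
apply/eqmodP/equivP => v Vv /=.
by rewrite !(mevalM, mevalD, mevalN, mevalC, meval1); ring.
Qed.
HB.instance Definition _ :=
  GRing.isZmodMorphism.Build k type const const_zmod_morphism.

Lemma const_monoid_morphism : monoid_morphism const.
Proof.
split=> // c e; rewrite -[RHS]/(mul (const c) (const e)) !piE.
by apply/eqmodP/equivP => v Vv /=; rewrite !(mevalM, mevalC, meval1); ring.
Qed.
HB.instance Definition _ :=
  GRing.isMonoidMorphism.Build k type const const_monoid_morphism.

End FunctionField.
End FunctionField.
HB.export FunctionField.

Notation function_field := FunctionField.type.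
Notation constant_function V := (@FunctionField.const _ V).

Definition is_algebraic_closure (K : fieldType) (L : closedFieldType)
    (iota : {rmorphism K -> L}) : Prop :=
  forall x : L, algebraicOver iota x.

Definition forward_orbit_finite (L : fieldType) (f : {poly L}) (x : L) : Prop :=
  exists s : seq L, forall n : nat, iter n (fun z => f.[z]) x \in s.

(* Critical points are the zeros of f'; when f' = 0 every point is critical. *)
Definition post_critically_finite (L : closedFieldType) (f : {poly L}) : Prop :=
  forall c : L, root f^`() c -> forward_orbit_finite f c.

(* Main.v *)
Require Import Defs.
From HB Require Import structures.
From mathcomp Require Import all_boot all_algebra.
From mathcomp Require Import boolp classical_sets ring zify.
Import GRing.Theory.
Local Open Scope ring_scope.

(**
  Let b_1, ..., b_m be the roots of g over L, and suppose that some b_i is not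
  in k.  As k is algebraically closed, b_i is not in k[1/b_i], and a subring of
  L maximal among those containing 1/b_i but not b_i is a valuation ring O, with
  maximal ideal M.  Let a be a root of g of largest absolute value, so |a| > 1.
  A point v with finite orbit under f(z) = g(z^d) has |v|^d <= |a|, for otherwise
  |f^n(v)| would increase strictly; hence |v| < |a| since d >= 2.

  This applies to g(0) and to g(c) for every root c of g', because 0 and the
  d-th roots of c are critical for f (even when p divides d).  Put
  h(w) = a^-m g(a w), a polynomial over O with 1 among its roots.  Then h(0) and
  all critical values of h lie in M.  Modulo M, each critical point of h is thus
  a root of h, and since m < p a residue class containing e > 0 roots of h
  contains exactly e - 1 critical points.  There are m - 1 critical points in
  all, so the roots of h form a single class; but it contains 1, and an element
  of M because h(0) is in M.
*)

Set Implicit Arguments.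
Unset Strict Implicit.

(** * Subrings maximal among those avoiding a given element *)

Definition valuation_ring (L : fieldType) (O : {pred L}) : Prop :=
  subring_closed O /\ forall x, (x \in O) || (x^-1 \in O).

Definition adjoin (L : fieldType) (A : {pred L}) (x : L) : {pred L} :=
  fun y => `[< exists2 q, q \is a polyOver A & y = q.[x] >].

Definition maximal_avoiding (L : fieldType) (O : {pred L}) (b : L) : Prop :=
  [/\ subring_closed O, b^-1 \in O, b \notin O &
      forall B : {pred L}, subring_closed B -> {subset O <= B} -> b \notin B ->
        {subset B <= O}].

Section Adjoin.
Variables (L : fieldType) (A : {pred L}) (subA : subring_closed A).
HB.instance Definition _ := GRing.isSubringClosed.Build L A subA.

Lemma adjoin_subring x : subring_closed (adjoin A x).
Proof.
split=> [|y z|y z].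
- by apply/asboolP; exists 1; rewrite ?rpred1 ?hornerC.
- move=> /asboolP[q Aq ->] /asboolP[r Ar ->]; apply/asboolP.
  by exists (q - r); rewrite ?rpredB // hornerD hornerN.
- move=> /asboolP[q Aq ->] /asboolP[r Ar ->]; apply/asboolP.
  by exists (q * r); rewrite ?rpredM // hornerM.
Qed.

Lemma subset_adjoin x : {subset A <= adjoin A x}.
Proof.
by move=> y Ay; apply/asboolP; exists y%:P; rewrite ?hornerC ?polyOverC.
Qed.

Lemma mem_adjoin x : x \in adjoin A x.
Proof. by apply/asboolP; exists 'X; rewrite ?hornerX ?polyOverX. Qed.

End Adjoin.

Lemma asbool_subring (L : fieldType) (A : {pred L}) :
  subring_closed A -> subring_closed (fun x => `[< x \in A >]).
Proof.
by case=> A1 AB AM; split=> [|x y|x y]; rewrite ?unfold_in !asboolb;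
  [exact: A1 | exact: AB | exact: AM].
Qed.

Lemma exists_maximal_avoiding (L : fieldType) (A : {pred L}) (b : L) :
  subring_closed A -> b^-1 \in A -> b \notin A ->
  exists O : {pred L}, maximal_avoiding O b.
Proof.
move=> subA bVA bA.
pose good (X : set L) :=
  [/\ subring_closed (fun x => `[< X x >]), X b^-1 & ~ X b].
(* [Zorn_bigcup] also covers the empty chain, whose union is not a subring; hence the case [set0],
   excluded for the maximal set because [A] is good. *)
pose P (X : set L) := X = set0 \/ good X.
have [F FP totF|O [PO maxO]] := @Zorn_bigcup L P.
  have [[X0 FX0 gX0]|noX] := pselect (exists2 X, F X & good X); last first.
    left; rewrite -subset0 => y [X FX Xy].
    by case: (FP X FX) => [X0|gX]; [rewrite X0 in Xy | case: noX; exists X].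
  have both x y : (\bigcup_(X in F) X)%classic x -> (\bigcup_(X in F) X)%classic y ->
      exists X, [/\ F X, good X, X x & X y].
    move=> [X FX Xx] [Y FY Yy].
    have nz (Z : set L) z : F Z -> Z z -> good Z.
      by move=> /FP [-> //|].
    case: (totF X Y FX FY) => XY.
      by exists Y; split=> //; [exact: nz Yy | exact: XY].
    by exists X; split=> //; [exact: nz Xx | exact: XY].
  right; split.
  - case: gX0 => [[o1 _ _] _ _]; split.
    + by apply/asboolP; exists X0 => //; apply/asboolP.
    + move=> x y /asboolP Ux /asboolP Uy.
      have [X [FX [[_ sX _] _ _] Xx Xy]] := both x y Ux Uy.
      apply/asboolP; exists X => //; apply/asboolP.
      by apply: sX; apply/asboolP.
    + move=> x y /asboolP Ux /asboolP Uy.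
      have [X [FX [[_ _ mX] _ _] Xx Xy]] := both x y Ux Uy.
      apply/asboolP; exists X => //; apply/asboolP.
      by apply: mX; apply/asboolP.
  - by exists X0 => //; case: gX0.
  - by move=> [X FX Xb]; case: (FP X FX) => [X_0|[]//]; rewrite X_0 in Xb.
have gA : good (fun x => x \in A).
  by split=> //; [exact: asbool_subring | exact/negP].
case: PO => [O0|[sO bVO bO]].
  case: (maxO (fun x => x \in A)); last by right.
  by rewrite O0; split; [exact: sub0set | move=> /(_ b^-1 bVA)].
exists (fun x => `[< O x >]); split=> //; first exact/asboolP.
  exact/asboolPn.
move=> B sB OB bB x Bx; apply/asboolP; apply: contrapT => nOx.
case: (maxO (fun x => x \in B)).
  split; last by move=> /(_ x Bx).
  by move=> y Oy; apply: OB; apply/asboolP.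
right; split; [exact: asbool_subring | | exact/negP].
by apply: OB; apply/asboolP.
Qed.

(** * Chevalley's theorem: such a maximal subring is a valuation ring *)

Section Chevalley.
Variables (L : fieldType) (O : {pred L}) (b : L).
Hypothesis maxO : maximal_avoiding O b.

Let subO : subring_closed O. Proof. by case: maxO. Qed.
HB.instance Definition _ := GRing.isSubringClosed.Build L O subO.

Let bVO : b^-1 \in O. Proof. by case: maxO. Qed.
Let bNO : b \notin O. Proof. by case: maxO. Qed.
Let b0 : b != 0. Proof. by apply: contraNneq bNO => ->; exact: rpred0. Qed.

(** The ideal b^-1 O, proper since b is not in O. It plays the part of the maximal ideal in
    Chevalley's argument. *)
Let I : {pred L} := fun x => b * x \in O.
Let in_I x : (x \in I) = (b * x \in O). Proof. by []. Qed.

Let addI x y : x \in I -> y \in I -> x + y \in I.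
Proof. by rewrite !in_I mulrDr; apply: rpredD. Qed.

Let mulI x y : x \in I -> y \in O -> x * y \in I.
Proof. by rewrite !in_I mulrA; apply: rpredM. Qed.

Let subI x : x \in I -> x \in O.
Proof. by rewrite in_I => bx; rewrite -(mulKf b0 x) rpredM. Qed.

Let oneI : 1 \notin I. Proof. by rewrite in_I mulr1. Qed.

Let sumI n (E : nat -> L) :
  (forall i, (i < n)%N -> E i \in I) -> \sum_(i < n) E i \in I.
Proof. by move=> EI; rewrite in_I mulr_sumr rpred_sum // => i _; apply: EI. Qed.

(** By maximality O[x] contains b; dividing an expression of b as a polynomial in x by b gives 1,
    with coefficients in b^-1 O. *)
Let relation x : x \notin O ->
  exists2 q : {poly L}, (forall i, q`_i \in I) & q.[x] = 1.
Proof.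
move=> xO; have [_ _ _ maxB] := maxO.
have : b \in adjoin O x.
  apply: contraNT xO => /maxB; apply; rewrite ?mem_adjoin //.
    exact: adjoin_subring.
  exact: subset_adjoin.
move=> /asboolP[q Oq bq]; exists (b^-1 *: q).
  by move=> i; rewrite coefZ in_I mulrA divff // mul1r (polyOverP Oq).
by rewrite hornerZ -bq mulVf.
Qed.

(** Put u = 1 - a. If u^-1 is not in O, its [relation] times a high power u^N puts u^N in I; but u^N
    is 1 modulo I, so 1 would be in I. *)
Let unit_1B a : a \in I -> 1 - a != 0 /\ (1 - a)^-1 \in O.
Proof.
move=> aI; have u0 : 1 - a != 0.
  by apply: contraNneq oneI => /eqP; rewrite subr_eq0 => /eqP ->.
split=> //; apply: contraT => /relation [q qI q1].
set u := 1 - a in u0 q1.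
have uO : u \in O by rewrite rpredB ?rpred1 // subI.
have uX n : 1 - u ^+ n \in I.
  elim: n => [|n IHn]; first by rewrite subrr in_I mulr0 rpred0.
  have -> : 1 - u ^+ n.+1 = (1 - u ^+ n) + a * u ^+ n.
    by rewrite /u exprS; ring.
  by rewrite addI // mulI // rpredX.
case/negP: oneI; rewrite -(subrK (u ^+ size q) 1) addI //.
rewrite -[u ^+ _]mul1r -q1 horner_coef mulr_suml.
apply: (sumI (E := fun i => q`_i * u^-1 ^+ i * u ^+ size q)) => i iq.
rewrite -mulrA mulI // exprVn.
by rewrite -(subnK (ltnW iq)) exprD mulrCA mulVf ?mulr1 ?rpredX ?expf_neq0.
Qed.

(** Chevalley's descent: of two relations, in x and in 1/x, the longer is shortened by means of the
    other, until one reads 0 = 1. By symmetry the longer is the one in x. *)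
Let no_relations n (x : L) (q r : {poly L}) : (size q + size r <= n)%N -> x != 0 ->
  (forall i, q`_i \in I) -> (forall i, r`_i \in I) ->
  q.[x] = 1 -> r.[x^-1] = 1 -> False.
Proof.
elim: n x q r => [|n IHn] x q r szn x0 qI rI qx rx.
  move: qx; have /eqP -> : q == 0.
    by rewrite -size_poly_eq0 -leqn0 (leq_trans _ szn) ?leq_addr.
  by rewrite horner0 => /eqP; rewrite eq_sym oner_eq0.
wlog le_rq : x q r szn x0 qI rI qx rx / (size r <= size q)%N.
  move=> hw; have [|/ltnW le_qr] := leqP (size r) (size q); first exact: (hw x q r).
  apply: (hw x^-1 r q) => //; rewrite ?invr_eq0 ?invrK //.
  by rewrite addnC.
(* The second relation expresses x^m through lower powers,
   which shortens the first one. *)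
case Eq : (size q) => [|m].
  move: qx; have /eqP -> : q == 0 by rewrite -size_poly_eq0 Eq.
  by rewrite horner0 => /eqP; rewrite eq_sym oner_eq0.
have [u0 uO] := unit_1B (rI 0); set u := 1 - r`_0 in u0 uO.
(* [q'] is [q] with its top term rewritten by x^m = sum over i < m of (r_(m-i) / u) x^i, where u = 1
   - r_0 is a unit of O by [unit_1B]. *)
pose q' := \poly_(i < m) (q`_i + q`_m * (r`_(m - i) / u)).
apply: (IHn x q' r _ x0 _ rI _ rx).
- by have := size_poly m (fun i => q`_i + q`_m * (r`_(m - i) / u)); rewrite -/q'; lia.
- move=> i; rewrite coef_poly; case: ltnP => _; last by rewrite in_I mulr0 rpred0.
  by rewrite addI // mulI // subI // mulI.
have xm : \sum_(i < m) r`_(m - i) / u * x ^+ i = x ^+ m.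
  move: rx; rewrite (@horner_coef_wide _ m.+1) -?Eq // Eq.
  rewrite big_ord_recl /= expr0 mulr1 => ru.
  have {}ru : u = \sum_(i < m) r`_(bump 0 i) * x^-1 ^+ bump 0 i.
    by rewrite /u -[X in X - _]ru [X in X - _]addrC addrK.
  have -> : x ^+ m = u^-1 * x ^+ m * u by rewrite mulrC mulrA divff ?mul1r.
  rewrite {3}ru mulr_sumr (reindex_inj rev_ord_inj) /=.
  apply: eq_bigr => i _; rewrite /bump /= subKn ?ltn_ord // add1n.
  rewrite exprVn.
  have -> : x ^+ m = x ^+ (m - i.+1) * x ^+ i.+1 by rewrite -exprD subnK.
  have : x ^+ i.+1 != 0 by rewrite expf_neq0.
  by move=> xi; field; rewrite xi u0.
rewrite /q' horner_poly -qx horner_coef Eq big_ord_recr /= -xm mulr_sumr -big_split /=.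
by apply: eq_bigr => i _; rewrite mulrDl -mulrA.
Qed.

Lemma maximal_avoiding_valuation_ring : valuation_ring O.
Proof.
split=> // x; apply: contraT; rewrite negb_or => /andP[xO xVO].
have x0 : x != 0 by apply: contraNneq xO => ->; exact: rpred0.
have [q qI qx] := relation xO; have [r rI rx] := relation xVO.
by case: (no_relations (leqnn _) x0 qI rI qx rx).
Qed.

End Chevalley.

(** * The maximal ideal, and multiplicities of roots modulo it *)

(** For a valuation ring O, membership in O reads |x| <= 1 and membership in [nonunits O] reads |x|
    < 1. Zero is listed apart because 0^-1 = 0 lies in O. *)
Definition nonunits (L : fieldType) (O : {pred L}) : {pred L} :=
  fun x => (x == 0) || (x^-1 \notin O).

Section ValuationRing.
Variables (L : fieldType) (O : {pred L}).
Hypothesis vO : valuation_ring O.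

Let subO : subring_closed O. Proof. by case: vO. Qed.
HB.instance Definition _ := GRing.isSubringClosed.Build L O subO.

Local Notation M := (nonunits O).

Lemma nonunitsE x : (x \in M) = (x == 0) || (x^-1 \notin O).
Proof. by []. Qed.

Lemma invr_notin_ring x : x \notin O -> x^-1 \in M.
Proof. by rewrite nonunitsE invrK => ->; rewrite orbT. Qed.

Lemma nonunits_sub x : x \in M -> x \in O.
Proof.
case/orP=> [/eqP->|xV]; first exact: rpred0.
by have [_ /(_ x)] := vO; rewrite (negPf xV) orbF.
Qed.

Lemma natr_in_ring n : n%:R \in O.
Proof. exact: rpred_nat. Qed.

Lemma expr_in_ring x n : x \in O -> x ^+ n \in O.
Proof. exact: rpredX. Qed.

Lemma nonunits1 : 1 \notin M.
Proof. by rewrite nonunitsE oner_eq0 invr1 rpred1. Qed.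

Lemma nonunitsM x y : x \in O -> y \in M -> x * y \in M.
Proof.
rewrite !nonunitsE => xO; have [->|x0] := eqVneq x 0; first by rewrite mul0r eqxx.
case/orP=> [/eqP->|yV]; first by rewrite mulr0 eqxx.
apply/orP; right; apply: contra yV => xyV.
by rewrite -[y^-1](mulKf x0) mulrCA -invfM rpredM.
Qed.

Lemma nonunits_prime x y :
  x \in O -> y \in O -> x * y \in M -> (x \in M) || (y \in M).
Proof.
move=> xO yO; rewrite !nonunitsE mulf_eq0 invfM.
case: eqP => //= _; case: eqP => //= _; rewrite ?orbT //.
by apply: contraR; rewrite negb_or !negbK => /andP[? ?]; exact: rpredM.
Qed.

Lemma nonunitsD x y : x \in M -> y \in M -> x + y \in M.
Proof.
wlog xy : x y / x / y \in O => [hw xM yM | xM yM].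
  have [_ /(_ (x / y))] := vO; case/orP=> [xy|]; first exact: hw.
  by rewrite invf_div addrC => yx; exact: hw.
have [->|y0] := eqVneq y 0; first by rewrite addr0.
have -> : x + y = (x / y + 1) * y by rewrite mulrDl mul1r divfK.
by rewrite nonunitsM // rpredD ?rpred1.
Qed.

Lemma nonunitsN x : (- x \in M) = (x \in M).
Proof. by rewrite !nonunitsE oppr_eq0 invrN rpredN. Qed.

Lemma nonunitsB x y : x \in M -> y \in M -> x - y \in M.
Proof. by move=> xM yM; rewrite nonunitsD ?nonunitsN. Qed.

Lemma nonunitsDr x y : x \in M -> (x + y \in M) = (y \in M).
Proof.
move=> xM; apply/idP/idP; last exact: nonunitsD.
by move=> /nonunitsB /(_ xM); rewrite addrAC subrr add0r.
Qed.

Lemma notin_ringM x y : x \notin O -> y \notin O -> x * y \notin O.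
Proof.
move=> xO yO; have y0 : y != 0 by apply: contraNneq yO => ->; exact: rpred0.
apply: contra xO => xy; rewrite -[x](mulfK y0) rpredM //.
exact/nonunits_sub/invr_notin_ring.
Qed.

Lemma notin_ringX x n : x \notin O -> x ^+ n.+1 \notin O.
Proof.
by move=> xO; elim: n => [|n IHn]; rewrite ?expr1 // exprS notin_ringM.
Qed.

Lemma notin_ring_prod (s : seq L) :
  s != [::] -> all (fun x => x \notin O) s -> \prod_(x <- s) x \notin O.
Proof.
elim: s => // x [|y s] IHs _ /= /andP[xO sO]; first by rewrite big_seq1.
by rewrite big_cons notin_ringM // IHs.
Qed.

Lemma nonunits_prod (s : seq L) :
  all (mem O) s -> \prod_(x <- s) x \in M -> has (mem M) s.
Proof.
elim: s => [|x s IHs] /=; first by rewrite big_nil (negPf nonunits1).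
case/andP=> xO sO; rewrite big_cons => /nonunits_prime.
have pO : \prod_(y <- s) y \in O by rewrite big_seq rpred_prod // => y /(allP sO).
by case/(_ xO pO)/orP=> [->//|/(IHs sO) ->]; rewrite orbT.
Qed.

(* The reduction modulo M of the product has 0 as a root of multiplicity
   count M s: this reads multiplicities off the coefficients without building
   the residue field. *)
Lemma coef_prod_XsubC_nonunits (s : seq L) : all (mem O) s ->
  let q := \prod_(x <- s) ('X - x%:P) in
  [/\ q \is a polyOver O, forall i, (i < count (mem M) s)%N -> q`_i \in M
    & q`_(count (mem M) s) \notin M].
Proof.
elim: s => [|x s IHs] /=.
  by rewrite big_nil; split; rewrite ?rpred1 // coef1 nonunits1.
case/andP=> xO /IHs[]; rewrite big_cons.
set q := \prod_(x <- s) _; set a := count _ _ => qO qM qa.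
(* Modulo M, multiplication by X - x is a shift if x is in M; otherwise the lowest nonzero
   coefficient stays in place, times -x. *)
have coefE i : (('X - x%:P) * q)`_i = (if i is j.+1 then q`_j else 0) - x * q`_i.
  by rewrite mulrBl coefB coefXM coefCM; case: i.
have M0 : 0 \in M by rewrite nonunitsE eqxx.
split; first by rewrite rpredM // polyOverXsubC.
  move=> i; rewrite coefE; case: (boolP (x \in M)) => xM /= ia.
    rewrite nonunitsB //; last first.
      by rewrite mulrC nonunitsM // (polyOverP qO).
    by case: i ia => // i; rewrite add1n ltnS => /qM.
  rewrite add0n in ia; rewrite nonunitsB //; last by rewrite nonunitsM // qM.
  by case: i ia => // i /ltnW /qM.
rewrite coefE; case: (boolP (x \in M)) => xM.
  rewrite add1n addrC nonunitsDr // nonunitsN mulrC nonunitsM //.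
  exact: (polyOverP qO).
rewrite add0n nonunitsDr; last first.
  by case: (a) qM => // j qM; exact: qM.
rewrite nonunitsN; apply: contra qa => /nonunits_prime.
by case/(_ xO (polyOverP qO _))/orP=> // xM'; rewrite xM' in xM.
Qed.

(** Over the residue field a zero of order e > 0 becomes a zero of order e - 1 of the derivative, as
    e is invertible there. Both orders are the index of the first coefficient outside M. *)
Lemma count_deriv_roots (s t : seq L) (c : L) :
  all (mem O) s -> all (mem O) t -> c \in O -> c \notin M ->
  (forall n, (0 < n <= size s)%N -> n%:R \notin M) ->
  (\prod_(x <- s) ('X - x%:P))^`() = c *: \prod_(x <- t) ('X - x%:P) ->
  has (mem M) s -> count (mem M) s = (count (mem M) t).+1.
Proof.
move=> sO tO cO cM unitn.
have [] := coef_prod_XsubC_nonunits sO; have [] := coef_prod_XsubC_nonunits tO.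
set q := \prod_(x <- s) _; set r := \prod_(x <- t) _.
set at_ := count _ t; set as_ := count _ s => rO rM ra qO qM qa dq.
rewrite has_count -/as_; case Ea : as_ => [//|a] _; rewrite Ea in qM qa.
have coefE i : c * r`_i = i.+1%:R * q`_i.+1.
  by have := coef_deriv q i; rewrite dq coefZ mulr_natl.
have a_le : (a < size s)%N by rewrite -Ea /as_ count_size.
have nO n : n%:R \in O by exact: rpred_nat.
have qiO i : q`_i \in O by exact: (polyOverP qO).
have riO i : r`_i \in O by exact: (polyOverP rO).
(* At the smaller of two distinct indices, [coefE] would equate an element of M with a product of
   two elements outside M. *)
have [lt|lt|->//] := ltngtP a at_.
  have : a.+1%:R * q`_a.+1 \in M by rewrite -coefE nonunitsM // rM.
  by move/(nonunits_prime (nO _) (qiO _)); rewrite (negPf qa) (negPf (unitn _ _)).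
have : c * r`_at_ \in M by rewrite coefE nonunitsM // qM.
by move/(nonunits_prime cO (riO _)); rewrite (negPf cM) (negPf ra).
Qed.

Lemma prod_XsubC_shift (s : seq L) (x : L) :
  \prod_(y <- [seq y - x | y <- s]) ('X - y%:P)
    = (\prod_(y <- s) ('X - y%:P)) \Po ('X + x%:P).
Proof.
rewrite big_map rmorph_prod /=; apply: eq_bigr => y _.
by rewrite comp_polyB comp_polyX comp_polyC polyCB; ring.
Qed.

(** Translation by x carries the class of x to M, where [count_deriv_roots] applies. *)
Lemma count_deriv_roots_at (s t : seq L) (c x : L) :
  x \in O -> all (mem O) s -> all (mem O) t -> c \in O -> c \notin M ->
  (forall n, (0 < n <= size s)%N -> n%:R \notin M) ->
  (\prod_(y <- s) ('X - y%:P))^`() = c *: \prod_(y <- t) ('X - y%:P) ->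
  has (fun y => y - x \in M) s ->
  count (fun y => y - x \in M) s = (count (fun y => y - x \in M) t).+1.
Proof.
move=> xO sO tO cO cM unitn ds hs.
have shiftO (u : seq L) : all (mem O) u -> all (mem O) [seq y - x | y <- u].
  by move=> /allP uO; apply/allP => _ /mapP[y /uO yO ->] /=; exact: rpredB.
have := @count_deriv_roots [seq y - x | y <- s] [seq y - x | y <- t] c
  (shiftO _ sO) (shiftO _ tO) cO cM.
rewrite size_map !count_map has_map => -> //.
rewrite !prod_XsubC_shift deriv_comp ds derivD derivX derivC addr0 mulr1.
exact: comp_polyZ.
Qed.

End ValuationRing.

(** * Comparing two lists class by class *)

Section CountClasses.
Variables (T : eqType) (e : rel T).
Hypotheses (e_sym : symmetric e) (e_trans : transitive e).

(** Meant for [s] the roots of h, [t] its critical points and [e] congruence modulo M. *)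
Let excess_one (s t : seq T) :=
  (forall x, x \in s -> count (e x) s = (count (e x) t).+1) /\
  (forall c, c \in t -> has (e c) s).

Let excess_one_filter (s t : seq T) x : excess_one s t ->
  excess_one (filter (predC (e x)) s) (filter (predC (e x)) t).
Proof.
have cross y z : ~~ e x y -> e y z -> ~~ e x z.
  by move=> xy yz; apply: contra xy => xz; rewrite (e_trans xz) // e_sym.
move=> [cnt cov]; split=> [y|c].
  rewrite mem_filter => /andP[/= xy ys].
  have eqc u : count (e y) (filter (predC (e x)) u) = count (e y) u.
    rewrite count_filter; apply: eq_count => z /=.
    by apply: andb_idr; exact: cross.
  by rewrite !eqc cnt.
rewrite mem_filter => /andP[/= xc /cov /hasP[y ys cy]].
by apply/hasP; exists y; rewrite // mem_filter /= ys (cross c).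
Qed.

Let size_filter_class (s t : seq T) x : excess_one s t -> x \in s ->
  size s = (count (e x) t + size (filter (predC (e x)) s)).+1 /\
  size t = (count (e x) t + size (filter (predC (e x)) t))%N.
Proof.
by move=> [cnt _] xs; rewrite !size_filter -addSn -cnt // !count_predC.
Qed.

(** Classes are removed one at a time, each taking one more element from s than from t. An empty s
    forces an empty t, so the truncated predecessor is harmless. *)
Let excess_one_size (s t : seq T) : excess_one s t -> (size t <= (size s).-1)%N.
Proof.
have [n] := ubnP (size s); elim: n s t => // n IHn [|x s] t szn ex.
  by case: t ex => // c t [_ /(_ c (mem_head _ _))].
have [eqs eqt] := size_filter_class ex (mem_head x s).
have := IHn _ _ _ (excess_one_filter x ex); lia.
Qed.

(** A second class would make s exceed t by at least two: one for the class of x, one for what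
    remains after its removal. *)
Lemma excess_one_single_class (s t : seq T) : size s = (size t).+1 ->
  (forall x, x \in s -> count (e x) s = (count (e x) t).+1) ->
  (forall c, c \in t -> has (e c) s) -> {in s &, forall x y, e x y}.
Proof.
move=> szs cnt cov x y xs ys; apply: contraT => xy.
have ex : excess_one s t by [].
have [eqs eqt] := size_filter_class ex xs.
have := excess_one_size (excess_one_filter x ex).
have : (0 < size (filter (predC (e x)) s))%N.
  by rewrite size_filter -has_count; apply/hasP; exists y.
lia.
Qed.

End CountClasses.

(** * Polynomials whose critical values lie in the maximal ideal *)

Section CriticalValues.
Variables (L : closedFieldType) (O : {pred L}).
Hypothesis vO : valuation_ring O.

Let subO : subring_closed O. Proof. by case: vO. Qed.
HB.instance Definition _ := GRing.isSubringClosed.Build L O subO.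

(** If c is outside O, so is every factor c - y, hence the product; if c is in O, primality of M
    puts some factor into M. *)
Lemma nonunits_root_near (s : seq L) (c : L) : s != [::] -> all (mem O) s ->
  (\prod_(x <- s) ('X - x%:P)).[c] \in nonunits O ->
  c \in O /\ has (fun y => y - c \in nonunits O) s.
Proof.
move=> s0 sO; rewrite horner_prod.
under eq_bigr do rewrite hornerXsubC.
rewrite -(big_map (fun y => c - y) xpredT id) => pM.
have [cO|cO] := boolP (c \in O).
  split=> //; have : all (mem O) [seq c - y | y <- s].
    by apply/allP => _ /mapP[y ys ->]; apply: rpredB => //; exact: (allP sO).
  move=> /(nonunits_prod vO) /(_ pM); rewrite has_map => /hasP[y ys /= cy].
  by apply/hasP; exists y; rewrite // -opprB nonunitsN.
have : \prod_(y <- [seq c - y | y <- s]) y \notin O.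
  apply: notin_ring_prod => //; first by rewrite -size_eq0 size_map size_eq0.
  by apply/allP => _ /mapP[y /(allP sO) yO ->]; rewrite rpredBr.
by rewrite (nonunits_sub vO pM).
Qed.

Lemma roots_congruent (s : seq L) :
  all (mem O) s ->
  (forall n, (0 < n <= size s)%N -> n%:R \notin nonunits O) ->
  (forall c, root (\prod_(x <- s) ('X - x%:P))^`() c ->
     (\prod_(x <- s) ('X - x%:P)).[c] \in nonunits O) ->
  {in s &, forall x y, y - x \in nonunits O}.
Proof.
move=> sO unitn crit.
have [-> //|s0] := eqVneq s [::].
set h := \prod_(x <- s) _ in crit; set m := size s in unitn.
have m_gt0 : (0 < m)%N by rewrite /m lt0n size_eq0.
have sz_h : size h = m.+1 by rewrite size_prod_XsubC.
have h_lead : h`_m = 1.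
  by have /monicP := monic_prod_XsubC s xpredT id; rewrite lead_coefE -/h sz_h.
have mM : m%:R \notin nonunits O by rewrite unitn // m_gt0 leqnn.
have coef_dh : h^`()`_m.-1 = m%:R by rewrite coef_deriv prednK // h_lead.
have m0 : m%:R != 0 :> L.
  by apply: contraNneq mM => ->; rewrite nonunitsE eqxx.
(* As m is nonzero in L, h' has full degree m - 1, so [t] below lists exactly m - 1 critical
   points. *)
have sz_dh : size h^`() = m.
  apply/eqP; rewrite eqn_leq; apply/andP; split.
    by rewrite -ltnS -sz_h lt_size_deriv // -size_poly_gt0 sz_h.
  rewrite leqNgt; apply/negP => lt; case/negP: m0.
  by rewrite -coef_dh nth_default // -ltnS prednK.
have [t dh] := closed_field_poly_normal h^`().
have lead_dh : lead_coef h^`() = m%:R by rewrite lead_coefE sz_dh.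
rewrite lead_dh in dh.
have sz_t : m = (size t).+1.
  by rewrite -sz_dh dh size_scale // size_prod_XsubC.
have roots_t c : c \in t -> c \in O /\ has (fun y => y - c \in nonunits O) s.
  move=> ct; have : root h^`() c by rewrite dh rootZ // root_prod_XsubC.
  by move=> /crit; exact: nonunits_root_near.
have tO : all (mem O) t by apply/allP => c /roots_t[].
pose e : rel L := fun x y => y - x \in nonunits O.
have e_refl : reflexive e by move=> x; rewrite /e subrr nonunitsE eqxx.
have e_sym : symmetric e by move=> x y; rewrite /e -opprB nonunitsN.
have e_trans : transitive e.
  move=> y x z; rewrite /e => yx zy.
  by rewrite -(subrK y z) -addrA; exact: nonunitsD.
apply: (@excess_one_single_class _ e e_sym e_trans s t sz_t).
  move=> x xs; apply: (count_deriv_roots_at vO _ sO tO (natr_in_ring vO m) mM) => //.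
    exact: (allP sO).
  by apply/hasP; exists x => //; exact: e_refl.
by move=> c /roots_t[].
Qed.

End CriticalValues.

(** * A root of largest absolute value, and escape of orbits *)

Lemma exists_dominant (L : fieldType) (O : {pred L}) (s : seq L) (b : L) :
  valuation_ring O -> b \in s -> b \notin O ->
  exists2 a, a \in s & a \notin O /\ {in s, forall x, x / a \in O}.
Proof.
move=> vO bs bO; have [[o1 sB sM] tot] := vO.
have O0 : 0 \in O by rewrite -(subrr 1); exact: sB.
have b0 : b != 0 by apply: contraNneq bO => ->.
(* The induction runs over lists that may miss b, possibly all zeros. The condition [a != 0]
   matters: x / 0 = 0 is always in O. *)
suff : {in s, forall x, x = 0} \/
    exists2 a, a \in s & a != 0 /\ {in s, forall x, x / a \in O}.
  case=> [/(_ b bs)/eqP|[a as_ [a0 dom]]]; first by rewrite (negPf b0).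
  exists a => //; split=> //; apply: contra bO => aO.
  by rewrite -(divfK a0 b) sM // dom.
elim: s {bs} => [|y s IHs]; first by left.
have [-> | y0] := eqVneq y 0.
  case: IHs => [s0|[a as_ [a0 dom]]].
    by left=> x; rewrite inE => /orP[/eqP|/s0].
  right; exists a; first by rewrite inE as_ orbT.
  by split=> // x; rewrite inE => /orP[/eqP->|/dom//]; rewrite mul0r.
right; case: IHs => [s0|[a as_ [a0 dom]]].
  exists y; first exact: mem_head.
  split=> // x; rewrite inE => /orP[/eqP->|/s0->]; by rewrite ?divff ?mul0r.
have [ya|ya] := boolP (y / a \in O).
  exists a; first by rewrite inE as_ orbT.
  by split=> // x; rewrite inE => /orP[/eqP->|/dom].
have {ya tot} ay : a / y \in O.
  by have := tot (y / a); rewrite (negPf ya) invf_div.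
exists y; first exact: mem_head.
split=> // x; rewrite inE => /orP[/eqP->|xs]; first by rewrite divff.
by rewrite -(divfK a0 x) -mulrA sM // dom.
Qed.

Section Escape.
Variables (L : fieldType) (O : {pred L}) (s : seq L) (a : L) (d : nat).
Hypotheses (vO : valuation_ring O) (as_ : a \in s) (aO : a \notin O).
Hypotheses (dom : {in s, forall x, x / a \in O}) (d_ge2 : (2 <= d)%N).

Let subO : subring_closed O. Proof. by case: vO. Qed.
HB.instance Definition _ := GRing.isSubringClosed.Build L O subO.

Let F (w : L) := \prod_(x <- s) (w ^+ d - x).

Let a0 : a != 0. Proof. by apply: contraNneq aO => ->; exact: rpred0. Qed.

Let aVO : a^-1 \in O. Proof. exact/(nonunits_sub vO)/invr_notin_ring. Qed.

(** From |x| <= |a| < |w|^d follows |w^d - x| = |w|^d for every x in s. One factor, divided by w,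
    has absolute value |w|^(d-1) > 1; the others have |w|^d > 1. *)
Let escape_ratio w : w ^+ d / a \notin O -> F w / w \notin O.
Proof.
move=> wa; have wO : w \notin O.
  by apply: contra wa => wO; rewrite rpredM ?rpredX.
have w0 : w != 0 by apply: contraNneq wO => ->; exact: rpred0.
have wd0 : w ^+ d != 0 by rewrite expf_neq0.
have factor x : x \in s -> (w ^+ d - x) / w \notin O.
  move=> xs; have xw : x / w ^+ d \in nonunits O.
    have -> : x / w ^+ d = x / a * (a / w ^+ d) by rewrite mulrA divfK.
    apply: (nonunitsM vO (dom xs)).
    by rewrite -[a / _]invf_div invr_notin_ring.
  have : 1 - x / w ^+ d \notin nonunits O.
    by rewrite addrC nonunitsDr ?nonunitsN ?nonunits1.
  rewrite nonunitsE negb_or negbK => /andP[u0 uV].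
  apply: contra (notin_ringX vO (d - 2) wO) => xwO.
  have -> : w ^+ (d - 2).+1 = (w ^+ d - x) / w * (1 - x / w ^+ d)^-1.
    have Eu : w ^+ d - x = (1 - x / w ^+ d) * w ^+ d by rewrite mulrBl mul1r divfK.
    have Ed : w ^+ d = w ^+ (d - 2).+1 * w by rewrite -exprSr; congr (_ ^+ _); lia.
    rewrite Eu; move: u0; set u := 1 - _ => u0.
    by rewrite Ed mulrA mulfK // mulrAC divff // mul1r.
  by rewrite rpredM.
have factor' x : x \in s -> w ^+ d - x \notin O.
  by move=> /factor xs; rewrite -(divfK w0 (_ - _)) notin_ringM.
case: s as_ factor factor' @F => // x s' _ factor factor' /=.
rewrite big_cons mulrAC; have xF := factor x (mem_head _ _).
have [->|s0] := eqVneq s' [::]; first by rewrite big_nil mulr1.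
rewrite notin_ringM // -(big_map (fun y => w ^+ d - y) xpredT id).
rewrite notin_ring_prod //; first by rewrite -size_eq0 size_map size_eq0.
by apply/allP => _ /mapP[y ys ->] /=; rewrite factor' // inE ys orbT.
Qed.

(** The quotient is (F w / w)^d times w^d / a, both outside O. *)
Let escape_step w : w ^+ d / a \notin O -> (F w) ^+ d / a \notin O.
Proof.
move=> wa; have Fw := escape_ratio wa; have w0 : w != 0.
  apply: contraNneq wa => ->; rewrite expr0n; case: d d_ge2 => //= n _.
  by rewrite mul0r; exact: rpred0.
rewrite -(divfK w0 (F w)) exprMn -mulrA notin_ringM //.
by case: d d_ge2 => // n _; exact: notin_ringX.
Qed.

(** If |v|^d > |a|, absolute values increase strictly along the orbit; its iterates are then
    pairwise distinct and cannot all lie in [r]. *)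
Lemma finite_orbit_bounded (v : L) (r : seq L) :
  (forall n, iter n F v \in r) -> v ^+ d / a \in O.
Proof.
move=> orb; apply: contraT => va.
have big n : (iter n F v) ^+ d / a \notin O.
  by elim: n => //= n; exact: escape_step.
have nz n : iter n F v != 0.
  apply: contraNneq (big n) => ->; rewrite expr0n; case: d d_ge2 => //= j _.
  by rewrite mul0r; exact: rpred0.
have grow i j : iter (i + j.+1) F v / iter i F v \notin O.
  elim: j => [|j IHj]; first by rewrite addn1 /=; exact: escape_ratio.
  set y := iter (i + j.+1) F v in IHj *.
  rewrite addnS -[iter _.+1 F v]/(F y); set z := iter i F v in IHj *.
  have -> : F y / z = F y / y * (y / z) by rewrite mulrA divfK // nz.
  by rewrite notin_ringM //; exact/escape_ratio/big.
have inj : injective (fun n => iter n F v).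
  suff lt i j : (i < j)%N -> iter i F v != iter j F v.
    by move=> i j /eqP; case: (ltngtP i j) => // /lt /negPf; rewrite 1?eq_sym => ->.
  move=> ij; have := grow i (j - i.+1)%N; rewrite -addSnnS subnKC //.
  apply: contra => /eqP <-; rewrite divff ?nz //; exact: rpred1.
have := @uniq_leq_size _ [seq iter n F v | n <- iota 0 (size r).+1] r.
rewrite map_inj_uniq // iota_uniq size_map size_iota ltnn => /(_ isT).
by apply=> _ /mapP[n _ ->].
Qed.

(** If |v| >= |a|, then a^(d-1) = (a / v)^d (v^d / a) would be in O, although a is not and d - 1 >
    0. *)
Lemma finite_orbit_small (v : L) (r : seq L) :
  (forall n, iter n F v \in r) -> v / a \in nonunits O.
Proof.
move=> /finite_orbit_bounded va; apply: contraT; rewrite nonunitsE negb_or negbK.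
move=> /andP[]; rewrite mulf_eq0 invr_eq0 (negPf a0) orbF invf_div => v0 av.
case/negP: (notin_ringX vO (d - 2) aO).
have -> : a ^+ (d - 2).+1 = (a / v) ^+ d * (v ^+ d / a).
  rewrite expr_div_n mulrA divfK ?expf_neq0 //.
  have {2}-> : d = (d - 2).+2 by lia.
  by rewrite [in RHS]exprSr mulfK.
by rewrite rpredM ?rpredX.
Qed.

End Escape.

(** * Choice of the valuation ring, and the conclusion *)

Lemma exists_valuation_ring (k : closedFieldType) (L : fieldType)
    (phi : {rmorphism k -> L}) (b : L) :
  (forall c, b != phi c) -> exists2 O : {pred L}, valuation_ring O & b \notin O.
Proof.
move=> bk; have b0 : b != 0 by rewrite -(rmorph0 phi).
pose A : {pred L} := fun y => `[< exists q, y = (map_poly phi q).[b^-1] >].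
have [|||O maxO] := @exists_maximal_avoiding L A b.
- split.
  + by apply/asboolP; exists 1; rewrite rmorph1 hornerC.
  + move=> x y /asboolP[q ->] /asboolP[r ->]; apply/asboolP; exists (q - r).
    by rewrite rmorphB hornerD hornerN.
  + move=> x y /asboolP[q ->] /asboolP[r ->]; apply/asboolP; exists (q * r).
    by rewrite rmorphM hornerM.
- by apply/asboolP; exists 'X; rewrite map_polyX hornerX.
- apply/asboolPn => -[q bq].
  pose n := size q.
  (* Clearing denominators in b = q(1/b) makes b a root of the monic [r], which splits over k; so b
     would be in the image of [phi]. *)
  pose r : {poly k} := 'X^(n.+1) - \poly_(i < n.+1) q`_(n - i).
  have sz_r : size r = n.+2.
    by rewrite size_polyDl size_polyXn // size_polyN ltnS size_poly.
  have : root (map_poly phi r) b.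
    rewrite rootE rmorphB /= map_polyXn hornerD hornerN hornerXn subr_eq0.
    rewrite (@horner_coef_wide _ n.+1); last first.
      by rewrite size_map_poly size_poly.
    rewrite exprSr {2}bq (@horner_coef_wide _ n.+1) ?size_map_poly ?leqnSn //.
    rewrite mulr_sumr (reindex_inj rev_ord_inj) /=; apply/eqP; apply: eq_bigr => i _.
    rewrite subSS !coef_map coef_poly ltn_ord.
    rewrite mulrCA exprVn; congr (_ * _).
    have le_in : (i <= n)%N by rewrite -ltnS.
    have {1}-> : n = (i + (n - i))%N by rewrite subnKC.
    by rewrite exprD mulfK // expf_neq0.
  have [rs Er] := closed_field_poly_normal r.
  have r0 : lead_coef r != 0 by rewrite lead_coef_eq0 -size_poly_gt0 sz_r.
  rewrite Er map_polyZ rootZ ?fmorph_eq0 // rmorph_prod /=.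
  under eq_bigr do rewrite map_polyXsubC.
  rewrite -(big_map phi xpredT (fun x => 'X - x%:P)) root_prod_XsubC.
  by move=> /mapP[c _ bc]; have := bk c; rewrite bc eqxx.
exists O; first exact: maximal_avoiding_valuation_ring maxO.
by case: maxO.
Qed.

(** A Bezout relation u n = v p + 1 gives n the inverse u in L, a natural number and so in O. *)
Lemma pchar_nat_notin_nonunits (L : fieldType) (O : {pred L}) (p n : nat) :
  valuation_ring O -> p \in [pchar L] -> (0 < n < p)%N ->
  n%:R \notin nonunits O.
Proof.
move=> vO pL /andP[n_gt0 lt_np]; have p_pr := pcharf_prime pL.
have [u v E _] := egcdnP p n_gt0.
have : coprime n p by rewrite coprime_sym prime_coprime // gtnNdvd.
rewrite /coprime => /eqP g1.
have nu : u%:R * n%:R = 1 :> L.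
  by rewrite -natrM E g1 natrD natrM (pcharf0 pL) mulr0 add0r.
apply/negP => nM; case/negP: (nonunits1 vO); rewrite -nu nonunitsM //.
exact: natr_in_ring.
Qed.

Lemma pcf_roots_constant (k L : closedFieldType) (phi : {rmorphism k -> L})
    (p d : nat) (g : {poly L}) :
  p \in [pchar L] -> g \is monic -> (0 < (size g).-1 < p)%N -> (2 <= d)%N ->
  post_critically_finite (g \Po 'X^d) ->
  forall b, root g b -> exists c, b = phi c.
Proof.
move=> pL g_monic g_deg d_ge2 pcf b gb; apply: contrapT => bk.
have [c|O vO bO] := @exists_valuation_ring k L phi b.
  by apply/eqP => bc; apply: bk; exists c.
have [s Eg] := closed_field_poly_normal g.
rewrite (monicP g_monic) scale1r in Eg.
rewrite Eg size_prod_XsubC /= in g_deg.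
have bs : b \in s by rewrite -root_prod_XsubC -Eg.
have [a as_ [aO dom]] := exists_dominant vO bs bO.
have O0 : 0 \in O by rewrite nonunits_sub // nonunitsE eqxx.
have a0 : a != 0 by apply: contraNneq aO => ->.
pose F w := \prod_(x <- s) (w ^+ d - x).
have [n Ed] : exists n, d = n.+2 by exists (d - 2)%N; lia.
have FE w : (g \Po 'X^d).[w] = F w.
  rewrite horner_comp hornerXn Eg horner_prod.
  by apply: eq_bigr => x _; rewrite hornerXsubC.
have gF z w : z ^+ d = w -> g.[w] = F z.
  by move=> <-; rewrite -FE horner_comp hornerXn.
have crit_small z : root (g \Po 'X^d)^`() z -> F z / a \in nonunits O.
  (* The orbit of F z is a tail of the finite orbit of z. *)
  move=> /pcf [r orb]; apply: (@finite_orbit_small _ _ s _ d _ _ _ _ _ _ r) => // j.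
  have -> : iter j (fun w => \prod_(x <- s) (w ^+ d - x)) (F z) = iter j.+1 F z.
    by rewrite iterSr.
  by rewrite -(eq_iter FE).
have dgE z : ((g \Po 'X^d)^`()).[z] = g^`().[z ^+ d] * (z ^+ d.-1 *+ d).
  by rewrite deriv_comp hornerM horner_comp hornerXn derivXn hornerMn hornerXn.
have crit_g w : root g^`() w -> g.[w] / a \in nonunits O.
  (* [z] is a d-th root of w, hence critical because g'(z^d) = g'(w) = 0. *)
  move=> gw; have [|z zw] := @solve_monicpoly L d (fun i => if i == 0%N then w else 0).
    exact: ltnW.
  have zd : z ^+ d = w.
    rewrite zw Ed big_ord_recl /= expr0 mulr1.
    by rewrite big1 ?addr0 // => i _; rewrite mul0r.
  by rewrite (gF z) // crit_small // rootE dgE zd (rootP gw) mul0r.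
have crit_0 : g.[0] / a \in nonunits O.
  have z0 : (0 : L) ^+ d = 0 by rewrite Ed expr0n.
  by rewrite (gF 0) // crit_small // rootE dgE Ed [0 ^+ n.+2.-1]expr0n /= mul0rn mulr0.
pose s' := [seq x / a | x <- s]; pose h := \prod_(x <- s') ('X - x%:P).
have gh : g \Po (a *: 'X) = a ^+ size s *: h.
  rewrite Eg rmorph_prod /= /h big_map.
  elim: (s) => [|x u IHu]; first by rewrite !big_nil scale1r.
  rewrite !big_cons IHu comp_polyB comp_polyX comp_polyC.
  have -> : a *: 'X - x%:P = a *: ('X - (x / a)%:P).
    by rewrite scalerBr scale_polyC mulrC divfK.
  by rewrite -scalerAl -scalerAr scalerA exprS.
have gaE w : g.[a * w] = a ^+ size s * h.[w].
  by rewrite -hornerZ -gh horner_comp hornerZ hornerX.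
have aVO : a^-1 \in O by apply/(nonunits_sub vO)/invr_notin_ring.
have hM w : g.[a * w] / a \in nonunits O -> h.[w] \in nonunits O.
  (* The factor 1/a in the bound on g costs one power of a^-1; it is available since [s] contains
     a. *)
  have {1}-> : h.[w] = a^-1 ^+ (size s).-1 * (g.[a * w] / a).
    rewrite gaE; case: (s) as_ => // x u _ /=; rewrite exprS exprVn.
    have au0 : a ^+ size u != 0 by rewrite expf_neq0.
    by field; rewrite au0 a0.
  by move=> gM; apply: nonunitsM => //; exact: expr_in_ring.
have s'O : all (mem O) s' by apply/allP => _ /mapP[x xs ->]; exact: dom.
have s'0 : s' != [::] by rewrite -size_eq0 size_map size_eq0; case: (s) as_.
(* Since h(0) is in M, some root y of h is in M. The root a of g rescales to 1, so congruence of the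
   roots would put 1 in M. *)
have [|_ /hasP[y ys']] := nonunits_root_near vO (c := 0) s'0 s'O.
  by apply: hM; rewrite mulr0.
rewrite subr0 => yM.
have one_s' : 1 \in s' by apply/mapP; exists a; rewrite ?divff.
case/negP: (nonunits1 vO); rewrite -(subrK y 1) nonunitsD //.
apply: (roots_congruent vO s'O) => // [j|c /rootP h'c].
  rewrite size_map => /andP[j0 js]; apply: (pchar_nat_notin_nonunits vO pL).
  by rewrite j0; case/andP: g_deg => _; exact: leq_ltn_trans.
(* By the chain rule a g'(a c) = a^m h'(c) = 0 with m = [size s], so a c is a critical point of
   g. *)
apply/hM/crit_g/rootP; apply: (mulIf a0).
have := congr1 (fun q : {poly L} => q^`().[c]) gh.
rewrite deriv_comp !derivZ derivX hornerM horner_comp !hornerZ hornerX h'c.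
by rewrite hornerC mulr1 mul0r mulr0.
Qed.

Theorem theorem2 (k : closedFieldType) (p : nat) (k_char : p \in [pchar k])
    (V : irrQPVariety k) (g : {poly function_field V})
    (g_monic : g \is monic) (g_deg : (1 <= (size g).-1 < p)%N)
    (d : nat) (d_ge2 : (2 <= d)%N)
    (L : closedFieldType) (iota : {rmorphism function_field V -> L})
    (L_closure : is_algebraic_closure iota)
    (pcf : post_critically_finite (map_poly iota (g \Po 'X^d))) :
  forall i : nat, exists c : k, g`_i = constant_function V c.
Proof.
pose phi : {rmorphism k -> L} := iota \o constant_function V.
have pL : p \in [pchar L] by exact: (rmorph_pchar phi).
have gm : map_poly iota g \is monic by rewrite map_monic.
rewrite map_comp_poly map_polyXn in pcf.
rewrite -(size_map_poly iota) in g_deg.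
have const_root := pcf_roots_constant phi pL gm g_deg d_ge2 pcf.
have [s Eg] := closed_field_poly_normal (map_poly iota g).
rewrite (monicP gm) scale1r in Eg.
have [t Et] : exists t : seq k, s = map phi t.
  have : {in s, forall x, exists c, x = phi c}.
    by move=> x xs; apply: const_root; rewrite Eg root_prod_XsubC.
  elim: (s) => [|x u IHu] hu; first by exists [::].
  have [c ->] := hu x (mem_head _ _).
  have [|t ->] := IHu; last by exists (c :: t).
  by move=> y yu; apply: hu; rewrite inE yu orbT.
(* The constants are the coefficients of the polynomial over k with roots [t]; injectivity of [iota]
   brings the equality back from L to the function field. *)
move=> i; exists (\prod_(c <- t) ('X - c%:P))`_i.
apply: (fmorph_inj iota); rewrite -coef_map Eg Et big_map.
rewrite -[RHS]/(phi _) -coef_map; congr (nth 0 (polyseq _) i).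
by rewrite rmorph_prod; apply: eq_bigr => c _; rewrite /= map_polyXsubC.
Qed.
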